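(* For every positive integer $n$ and every real number $x$, the Chebyshev polynomial of the first kind $T_n$ satisfies $$T_n(x)=\frac{x^{\delta(n)}\,\Omega_0\big(\lfloor n/2\rfloor\,|\,1,\,2-4x^2\,|\,n\big)}{2^{\delta(n-1)}\,(n-1)(n-2)\cdots(n-\lfloor n/2\rfloor)}.$$
   Context: For an integer $m\ge 0$, $\delta(m)\in\{0,1\}$ is the residue of $m$ modulo $2$, and $t^0=1$ for every $t$. $T_0(x)=1$, $T_1(x)=x$, $T_{n+1}(x)=2xT_n(x)-T_{n-1}(x)$. For a positive integer $n$ and a point $(\zeta,\xi)\ne(0,0)$, the Omega sequence $\Omega_r(k|\zeta,\xi|n)$, for integers $r,k\ge 0$ with $r+k\le\lfloor n/2\rfloor$, is defined by $\Omega_r(0|\zeta,\xi|n)=1$ for all $r$ and, for $k\ge 1$, $$\Omega_r(k|\zeta,\xi|n)=(2\zeta-\xi)(n-r-k)\,\Omega_r(k-1|\zeta,\xi|n)-2\zeta\,(n-2r-\delta(n-1))\,\Omega_{r+1}(k-1|\zeta,\xi|n).$$ The product $(n-1)(n-2)\cdots(n-\lfloor n/2\rfloor)$ is $\prod_{j=1}^{\lfloor n/2\rfloor}(n-j)$; an empty product equals $1$. *)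

(* Defs.v *)
From mathcomp Require Import all_boot all_order all_algebra.
From mathcomp Require Import reals.

Set Implicit Arguments.
Unset Strict Implicit.
Unset Printing Implicit Defensive.

Import Order.TTheory GRing.Theory Num.Theory.
Local Open Scope ring_scope.

Definition delta (m : nat) : nat := (m %% 2)%N.

Fixpoint chebyshevT (R : comNzRingType) (n : nat) : {poly R} :=
  match n with
  | 0 => 1
  | n'.+1 => match n' with
             | 0 => 'X
             | m.+1 => 2%:R * 'X * chebyshevT R n' - chebyshevT R m
             end
  end.

(* [Omega r k zeta xi n] is Omega_r(k|zeta,xi|n).  The sequence is meant for
   0 < n, (zeta, xi) != (0, 0) and r + k <= n./2; the recursion below is total,
   and at an argument in that range it only calls arguments in that range.
   The integer factors are subtracted in R, so that no truncation occurs;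
   n.-1 is n - 1 because 0 < n. *)
Fixpoint Omega (R : comNzRingType) (r k : nat) (zeta xi : R) (n : nat) : R :=
  match k with
  | 0 => 1
  | k'.+1 =>
      (2%:R * zeta - xi) * (n%:R - r%:R - k%:R) * Omega r k' zeta xi n
      - 2%:R * zeta * (n%:R - (2 * r)%N%:R - (delta n.-1)%:R)
        * Omega r.+1 k' zeta xi n
  end.

(* Main.v *)
Require Import Defs.
From mathcomp Require Import all_boot all_order all_algebra.
From mathcomp Require Import reals.
From mathcomp Require Import zify ring.

Import Order.TTheory GRing.Theory Num.Theory.
Local Open Scope ring_scope.

(** Both sides are the classical explicit expansion of [T_n] in powers of
    [2x].

    The Omega recurrence has a closed solution for all [r], [k], [zeta], [xi]
    ([Omega_binomial]).  Unfold it [k] times: taking the second summand [j]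
    times and the first one [k - j] times contributes
    [(2 zeta - xi)^(k-j) (-2 zeta)^j] times integer factors that do not depend
    on the order of the choices, hence a binomial sum.  At [zeta = 1] and
    [xi = 2 - 4x^2] the base [2 zeta - xi] is [(2x)^2], so for [k = n/2] the
    sum runs over the powers [(2x)^(n-2j)], once [x^delta(n)] has restored the
    parity.

    On the other side [T_n = U_n - x U_(n-1)], where [U_n] is the Chebyshev
    polynomial of the second kind, whose coefficient at [(2x)^(n-2j)] is
    [(-1)^j 'C(n-j, j)].  Hence [2 T_n] has there the coefficient
    [(-1)^j (2 'C(n-j, j) - 'C(n-1-j, j))] ([chebyshevT_sum]).

    It remains to compare coefficients.  The factors [n - i] with
    [j < i <= n/2] of the denominator also occur in the Omega sum and cancel;
    multiplied by [j!], what is left on either side is the falling factorial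
    [n ^_ (2j)].  In the Omega sum this is because even and odd numbers
    interleave ([ffact_double]), in the Chebyshev sum because the factors
    [n - 1], ..., [n - j] of the denominator complete the coefficient
    ([ffact_chebyshev]). *)

(** The first-summand factor [n - r - k] is unchanged by a step
    [(r, k) -> (r+1, k-1)] and grows by 1 at a step [(r, k) -> (r, k-1)], while
    the second-summand factor only sees [r].  So all paths with [j] steps of
    the former kind contribute the same product, and there are ['C(k, j)] of
    them; Pascal's rule turns this count into an induction on [k]. *)
Lemma Omega_binomial (R : comNzRingType) (r k n : nat) (zeta xi : R) :
  Omega r k zeta xi n =
    \sum_(j < k.+1) (-1) ^+ j * 'C(k, j)%:R *
      (2%:R * zeta - xi) ^+ (k - j) * (2%:R * zeta) ^+ j *
      (\prod_(i < j) (n%:R - (2 * (r + i))%N%:R - (delta n.-1)%:R)) *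
      (\prod_(j <= i < k) (n%:R - r%:R - i.+1%:R)).
Proof.
elim: k r => [|k IHk] r.
  by rewrite big_ord1 /= !big_ord0 big_geq // bin0 !expr0 !mulr1.
rewrite /= !IHk.
set a := 2%:R * zeta - xi; set b := 2%:R * zeta.
rewrite [RHS]big_ord_recl /=.
under [X in _ = _ + X]eq_bigr => j _.
  rewrite /bump /= add1n binS natrD mulrDr 4!mulrDl subSS.
  over.
rewrite big_split /= addrA; congr (_ + _).
- transitivity (\sum_(j < k.+2) (-1) ^+ j * 'C(k, j)%:R * a ^+ (k.+1 - j) * b ^+ j *
     (\prod_(i < j) (n%:R - (2 * (r + i))%N%:R - (delta n.-1)%:R)) *
      (\prod_(j <= i < k.+1) (n%:R - r%:R - i.+1%:R))).
    rewrite [RHS]big_ord_recr /= bin_small // mulr0n mulr0 !mul0r addr0 mulr_sumr.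
    apply: eq_bigr => j _.
    have lejk : (j <= k)%N by rewrite -ltnS.
    by rewrite subSn // exprS big_nat_recr //=; ring.
  by rewrite big_ord_recl /= !bin0.
- rewrite mulr_sumr -sumrN; apply: eq_bigr => j _.
  rewrite big_ord_recl /= addn0 exprS [b ^+ _.+1]exprS.
  have -> : \prod_(i < j) (n%:R - (2 * (r.+1 + i))%N%:R - (delta n.-1)%:R) =
      \prod_(i < j) (n%:R - (2 * (r + bump 0 i))%N%:R - (delta n.-1)%:R) :> R.
    by apply: eq_bigr => i _; rewrite /bump /= add1n addnS addSn.
  have -> : \prod_(j <= i < k) (n%:R - r.+1%:R - i.+1%:R) =
      \prod_(j.+1 <= i < k.+1) (n%:R - r%:R - i.+1%:R) :> R.
    rewrite big_add1 /=; apply: eq_bigr => i _.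
    by rewrite -[r.+1]addn1 -[i.+2]addn1 !natrD; ring.
  by ring.
Qed.

(** The Chebyshev polynomial of the second kind, as a function of [t = 2x]. *)
Definition chebyshevU_sum (R : comNzRingType) (t : R) (n : nat) : R :=
  \sum_(j < n./2.+1) (-1) ^+ j * 'C(n - j, j)%:R * t ^+ (n - j.*2).

(** The binomial vanishes as soon as the subtraction in the exponent is
    truncated, so sums with different ranges can be combined. *)
Lemma chebyshevU_sum_widen (R : comNzRingType) (t : R) (n N : nat) :
  (n./2 < N)%N -> chebyshevU_sum R t n =
    \sum_(j < N) (-1) ^+ j * 'C(n - j, j)%:R * t ^+ (n - j.*2).
Proof.
move=> ltnN; rewrite /chebyshevU_sum.
rewrite (big_ord_widen N
  (fun j => (-1) ^+ j * 'C(n - j, j)%:R * t ^+ (n - j.*2))) //.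
rewrite big_mkcond /=; apply: eq_bigr => j _; case: ltnP => // lenj.
by rewrite bin_small ?mulr0n ?mulr0 ?mul0r //; lia.
Qed.

(** This is Pascal's rule [C(n+1-j, j+1) = C(n-j, j+1) + C(n-j, j)] in each
    coefficient. *)
Lemma chebyshevU_sumSS (R : comNzRingType) (t : R) (n : nat) :
  chebyshevU_sum R t n.+2 =
    t * chebyshevU_sum R t n.+1 - chebyshevU_sum R t n.
Proof.
rewrite [in LHS]/chebyshevU_sum big_ord_recl /=.
rewrite (@chebyshevU_sum_widen R t n.+1 n./2.+2); last lia.
rewrite [X in t * X]big_ord_recl /= !bin0 !subn0 mulrDr -addrA.
congr (_ + _); first by rewrite !exprS; ring.
rewrite mulr_sumr -sumrB; apply: eq_bigr => j _.
rewrite /bump /= add1n subSS.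
have ltj := ltn_ord j.
have -> : (n.+1 - j = (n - j).+1)%N by lia.
rewrite binS natrD subSS doubleS !subSS exprS.
have [lt2|ge2] := ltnP j.*2 n.
  have -> : (n - j.*2 = (n - j.*2.+1).+1)%N by lia.
  by rewrite [t ^+ _.+1]exprS; ring.
by rewrite ['C(n - j, j.+1)]bin_small; [ring|lia].
Qed.

(** Both sides satisfy the same three-term recurrence; in contrast with
    [2 T_n = U_n - U_(n-2)], this relation leads to coefficients without a
    special case at [j = 0]. *)
Lemma chebyshevT_U (R : comNzRingType) (n : nat) (x : R) :
  (chebyshevT R n.+1).[x] =
    chebyshevU_sum R (2%:R * x) n.+1 - x * chebyshevU_sum R (2%:R * x) n.
Proof.
have U0 t : chebyshevU_sum R t 0 = 1.
  by rewrite /chebyshevU_sum big_ord1 bin0 !expr0 !mulr1.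
have U1 t : chebyshevU_sum R t 1 = t.
  by rewrite /chebyshevU_sum big_ord1 bin0 subn0 expr0 expr1 !mul1r.
have TS k : (chebyshevT R k.+2).[x] =
    2%:R * x * (chebyshevT R k.+1).[x] - (chebyshevT R k).[x].
  have -> : chebyshevT R k.+2 =
      2%:R * 'X * chebyshevT R k.+1 - chebyshevT R k by [].
  by rewrite hornerD hornerN !hornerM hornerX -polyC_natr hornerC.
suff [-> _] : (chebyshevT R n.+1).[x] =
    chebyshevU_sum R (2%:R * x) n.+1 - x * chebyshevU_sum R (2%:R * x) n /\
  (chebyshevT R n.+2).[x] =
    chebyshevU_sum R (2%:R * x) n.+2 - x * chebyshevU_sum R (2%:R * x) n.+1 by [].
elim: n => [|n [IH1 IH2]].
  rewrite TS chebyshevU_sumSS U0 U1 /= hornerX hornerC; split; ring.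
split=> //; rewrite TS IH1 IH2 !(chebyshevU_sumSS _ _ n.+1).
by rewrite (chebyshevU_sumSS _ _ n); ring.
Qed.

Lemma chebyshevT_sum (R : comNzRingType) (n : nat) (x : R) : (0 < n)%N ->
  2%:R * (chebyshevT R n).[x] =
    \sum_(j < n./2.+1) (-1) ^+ j *
      (2%:R * 'C(n - j, j)%:R - 'C(n.-1 - j, j)%:R) * (2%:R * x) ^+ (n - j.*2).
Proof.
case: n => // n _; rewrite chebyshevT_U /= mulrBr mulrA.
rewrite (@chebyshevU_sum_widen R _ n n.+1./2.+1); last lia.
rewrite /chebyshevU_sum /= !mulr_sumr -sumrB; apply: eq_bigr => j _.
have [le2|gt2] := leqP j.*2 n.
  by rewrite (subSn le2) exprS; ring.
by rewrite ['C(n - j, j)]bin_small; [ring|lia].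
Qed.

(** One of [n], [n - 1] is [2 n./2] and the other is [n - delta (n-1)] for
    [n > 0], so the two decreasing sequences of step 2 on the left interleave
    into consecutive integers. *)
Lemma ffact_double (R : comNzRingType) (n j : nat) : (0 < n)%N ->
  2%:R ^+ j * (n./2 ^_ j)%:R *
    \prod_(i < j) (n%:R - (2 * i)%N%:R - (delta n.-1)%:R)
  = (n ^_ j.*2)%:R :> R.
Proof.
move=> n_gt0; elim: j => [|j IHj]; first by rewrite big_ord0 !ffactn0 !mul1r.
rewrite doubleS !ffactnSr !natrM -IHj exprS big_ord_recr /=.
have [lejm|ltmj] := ltnP j n./2; last first.
  (* Here [n] is at most [j.*2.+1], so both sides contain a zero factor. *)
  have -> : (n./2 - j = 0)%N by lia.
  have zero : ((n - j.*2) * (n - j.*2.+1) = 0)%N.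
    by apply/eqP; rewrite muln_eq0; lia.
  by rewrite -[RHS]mulrA -[X in _ = _ * X]natrM zero mulr0n !(mulr0, mul0r).
have -> : n%:R - (2 * j)%N%:R - (delta n.-1)%:R =
    (n - 2 * j - delta n.-1)%N%:R :> R.
  by rewrite /delta !natrB //; lia.
have key : ((n - j.*2) * (n - j.*2.+1) =
    2 * (n./2 - j) * (n - 2 * j - delta n.-1))%N.
  have [d0|d1] : delta n.-1 = 0%N \/ delta n.-1 = 1%N by rewrite /delta; lia.
  - have -> : (2 * (n./2 - j) = n - j.*2.+1)%N by rewrite /delta in d0; lia.
    by rewrite d0 subn0 mul2n mulnC.
  - have -> : (2 * (n./2 - j) = n - j.*2)%N by rewrite /delta in d1; lia.
    by rewrite d1 mul2n subn1 -subnS.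
move/(congr1 (fun k => k%:R : R)): key; rewrite !natrM => key.
rewrite -[RHS]mulrA key; ring.
Qed.

Lemma prod_ffact (R : comNzRingType) (n j : nat) : (j < n)%N ->
  n%:R * \prod_(0 <= i < j) (n%:R - i.+1%:R) = (n ^_ j.+1)%:R :> R.
Proof.
elim: j => [|j IHj] ltjn; first by rewrite big_geq // ffactn1 mulr1.
rewrite big_nat_recr //= mulrA IHj ?(ltnW ltjn) //.
by rewrite [(n ^_ j.+2)%N]ffactnSr natrM natrB ?(ltnW ltjn).
Qed.

Lemma ffactD (n i j : nat) : (n ^_ (i + j) = n ^_ i * (n - i) ^_ j)%N.
Proof.
elim: j => [|j IHj]; first by rewrite addn0 ffactn0 muln1.
by rewrite addnS !ffactnSr IHj -mulnA subnDA.
Qed.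

(** Since [(n-j) (n-1-j)^_j = (n-j)^_j (n-2j)], it follows that
    [(n-j) (2 (n-j)^_j - (n-1-j)^_j) = n (n-j)^_j]; the ratio [n / (n-j)] is
    what turns [(n-1) ... (n-j)] into [n^_j], and [n^_j (n-j)^_j = n^_(2j)]. *)
Lemma ffact_chebyshev (R : numDomainType) (n j : nat) : (0 < n)%N ->
  (j <= n./2)%N ->
  (j`!)%:R * (2%:R * 'C(n - j, j)%:R - 'C(n.-1 - j, j)%:R) *
    \prod_(0 <= i < j) (n%:R - i.+1%:R) = (n ^_ j.*2)%:R :> R.
Proof.
move=> n_gt0 lejm; have ltjn : (j < n)%N by lia.
have nj_neq0 : (n - j)%N%:R != 0 :> R by rewrite pnatr_eq0; lia.
have n_neq0 : n%:R != 0 :> R by rewrite pnatr_eq0; lia.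
apply: (mulfI n_neq0); apply: (mulfI nj_neq0).
have shift : ((n - j) * (n.-1 - j) ^_ j = (n - j) ^_ j * (n - j.*2))%N.
  have -> : (n.-1 - j = (n - j).-1)%N by lia.
  by rewrite -ffactnS ffactnSr -subnDA addnn.
move/(congr1 (fun k => k%:R : R)): shift; rewrite !natrM => shift.
have binE m : (j`!)%:R * 'C(m, j)%:R = (m ^_ j)%:R :> R.
  by rewrite -natrM mulnC bin_ffact.
have lhs : (n - j)%:R * ((j`!)%:R * (2%:R * 'C(n - j, j)%:R - 'C(n.-1 - j, j)%:R))
    = n%:R * ((n - j) ^_ j)%:R :> R.
  transitivity ((n - j)%:R * (2%:R * ((j`!)%:R * 'C(n - j, j)%:R)
      - (j`!)%:R * 'C(n.-1 - j, j)%:R) : R); first ring.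
  rewrite !binE mulrBr shift -addnn !natrB; [rewrite natrD; ring|lia|lia].
transitivity ((n - j)%:R * ((j`!)%:R * (2%:R * 'C(n - j, j)%:R - 'C(n.-1 - j, j)%:R))
   * (n%:R * \prod_(0 <= i < j) (n%:R - i.+1%:R)) : R); first ring.
rewrite lhs prod_ffact // ffactnSr natrM.
have -> : (n ^_ j.*2 = n ^_ j * (n - j) ^_ j)%N.
  by rewrite -addnn ffactD.
rewrite natrM; ring.
Qed.

Theorem theorem50 (R : realType) (n : nat) (n_gt0 : (0 < n)%N) (x : R) :
  (chebyshevT R n).[x] =
    (x ^+ delta n * Omega 0 n./2 1 (2%:R - 4%:R * x ^+ 2) n)
    / (2%:R ^+ delta n.-1 * \prod_(1 <= j < n./2.+1) (n%:R - j%:R)).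
Proof.
rewrite big_add1 /=.
set D := \prod_(_ <= _ < _) _.
have D_neq0 : D != 0.
  have ltmn : (n./2 < n)%N by lia.
  have : n%:R * D != 0 by rewrite prod_ffact // pnatr_eq0 -lt0n ffact_gt0.
  by rewrite mulf_eq0 negb_or => /andP[].
have two_neq0 : 2%:R != 0 :> R by rewrite pnatr_eq0.
apply: canRL (mulfK _) _; first by rewrite mulf_neq0 ?expf_neq0.
(* The factor [2 ^ delta n] turns [x ^ delta n] into a power of [2x] and
   completes [2 ^ delta n.-1] to the 2 in front of [T_n]. *)
apply: (mulfI (expf_neq0 (delta n) two_neq0)).
have deltaE : (delta n + delta n.-1 = 1)%N by rewrite /delta; lia.
transitivity (2%:R * (chebyshevT R n).[x] * D).
  by rewrite -[X in _ = X * _ * _]expr1 -deltaE exprD; ring.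
rewrite chebyshevT_sum // Omega_binomial mulrA -exprMn mulr_suml mulr_sumr.
apply: eq_bigr => j _.
have lejm : (j <= n./2)%N by rewrite -ltnS.
have baseE : 2%:R * 1 - (2%:R - 4%:R * x ^+ 2) = (2%:R * x) ^+ 2 by ring.
rewrite baseE -exprM mulr1 subr0.
have -> : (2%:R * x) ^+ (n - j.*2) =
    (2%:R * x) ^+ delta n * (2%:R * x) ^+ (2 * (n./2 - j)).
  by rewrite -exprD; congr (_ ^+ _); rewrite /delta; lia.
have coefE : (2%:R * 'C(n - j, j)%:R - 'C(n.-1 - j, j)%:R) *
    \prod_(0 <= i < j) (n%:R - i.+1%:R) =
    'C(n./2, j)%:R * 2%:R ^+ j *
    \prod_(i < j) (n%:R - (2 * (0 + i))%N%:R - (delta n.-1)%:R) :> R.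
  have fact_neq0 : (j`!)%:R != 0 :> R by rewrite pnatr_eq0 -lt0n fact_gt0.
  apply: (mulfI fact_neq0).
  rewrite mulrA ffact_chebyshev // -ffact_double // -bin_ffact natrM.
  by rewrite !mulrA; ring.
rewrite /D (@big_cat_nat _ _ _ j 0 n./2) //=.
set P := \prod_(0 <= i < j) _ in coefE *; set Q := \prod_(j <= i < _) _.
transitivity ((-1) ^+ j * ((2%:R * x) ^+ delta n *
  (2%:R * x) ^+ (2 * (n./2 - j))) * Q *
  ((2%:R * 'C(n - j, j)%:R - 'C(n.-1 - j, j)%:R) * P)); first ring.
by rewrite coefE; ring.
Qed.
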